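(* Let $N=4k$ with $k$ a positive integer, and let $G_N=(V_N,E_N)$ be the Hadamard graph. Consider the graph colouring game on $G_N$ with $c=N$ colours. If Alice and Bob follow the QFT protocol on $G_N$ (described in the context), then they win the game with probability $1$; that is, for every pair $(a,b)\in V_N\times V_N$ with $a=b$ or $(a,b)\in E_N$, with probability $1$ the colours $c_A,c_B$ they output satisfy: $c_A=c_B$ if $a=b$, and $c_A\neq c_B$ if $a\neq b$.
   Context: Hadamard graph: for $N=4k$, $k$ a positive integer, $G_N$ has vertex set $V_N=\{0,1\}^N$ and edge set $E_N=\{(u,v)\in V_N^2 : d_H(u,v)=N/2\}$, where $d_H$ is Hamming distance. The coordinates of $u\in V_N$ are indexed $u_0,\dots,u_{N-1}$. Graph colouring game on a graph $G=(V,E)$ with $c$ colours: a verifier sends $a\in V$ to Alice and $b\in V$ to Bob, where $a=b$ or $(a,b)\in E$. Alice and Bob, who may not communicate after receiving $a$ and $b$, answer with colours $c_A$ and $c_B$ respectively, out of $c$ possible colours. They win if ($a\ne b$ and $c_A\neq c_B$) or ($a=b$ and $c_A=c_B$), and lose otherwise. Before receiving $a,b$ they may agree on a protocol and share an entangled quantum state. QFT protocol on $G_N$. Let $|0\rangle,\dots,|N-1\rangle$ denote orthonormal computational basis vectors (realised among the $2^n$ basis states of $n$ qubits, where $2^{n-1}<N\le 2^n$; all states occurring stay in the span of these $N$ vectors for each player, so each player's system may be regarded as $\mathbb{C}^N$). Let $\omega=\exp(2\pi\sqrt{-1}/N)$. Let $\mathrm{QFT}_N$ be the unitary $|i\rangle\mapsto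 \frac{1}{\sqrt N}\sum_{j=0}^{N-1}\omega^{ij}|j\rangle$. For $l\in\{0,1\}^N$, let the phase shift determined by $l$ be the unitary $P_l:|i\rangle\mapsto(-1)^{l_i}|i\rangle$. Step 1 (before the questions are received): Alice and Bob share the state $|\Psi_{AB}\rangle=\frac{1}{\sqrt N}\sum_{i=0}^{N-1}|i\rangle\otimes|i\rangle$, Alice holding the first factor and Bob the second. Step 2: having received $a$ and $b$ respectively, Alice applies $P_a$ to her factor and Bob applies $P_b$ to his factor. Step 3: Alice applies $\mathrm{QFT}_N$ to her factor and Bob applies $\mathrm{QFT}_N^{-1}$ to his factor. Step 4: each measures their own factor in the computational basis; Alice's outcome $j_A\in\{0,\dots,N-1\}$ is her colour $c_A$, and Bob's outcome $j_B\in\{0,\dots,N-1\}$ is his colour $c_B$. Thus the probability of the outcome $(j_A,j_B)$ is $\left|\langle j_A|\otimes\langle j_B|\,(\mathrm{QFT}_N\otimes\mathrm{QFT}_N^{-1})(P_a\otimes P_b)|\Psi_{AB}\rangle\right|^2$. *)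

(* Defs.v *)
From HB Require Import structures.
From mathcomp Require Import all_boot all_order all_algebra.
From mathcomp Require Import complex mxtens.
From mathcomp Require Import all_classical all_reals all_analysis.

Set Implicit Arguments.
Unset Strict Implicit.
Unset Printing Implicit Defensive.

Import Order.TTheory GRing.Theory Num.Theory.
Local Open Scope ring_scope.
Local Open Scope complex_scope.
Local Open Scope sesquilinear_scope.

Definition bits (N : nat) : finType := {ffun 'I_N -> bool}.

Definition hamming (N : nat) (u v : bits N) : nat := #|[set i | u i != v i]|.

Definition hadamard_edge (N : nat) : rel (bits N) :=
  [rel u v | hamming u v == (N %/ 2)%N].

Definition legal_questions (V : finType) (E : rel V) (a b : V) : bool :=
  (a == b) || E a b.

Definition winning (V : finType) (c : nat) (a b : V) (cA cB : 'I_c) : bool :=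
  ((a != b) && (cA != cB)) || ((a == b) && (cA == cB)).

(* [p a b cA cB] is the probability that the players answer cA and cB when
   they are asked a and b. *)
Definition win_probability (R : realType) (V : finType) (c : nat)
    (p : V -> V -> 'I_c -> 'I_c -> R) (a b : V) : R :=
  \sum_(cA < c) \sum_(cB < c | winning a b cA cB) p a b cA cB.

Definition wins_with_probability_one (R : realType) (V : finType) (E : rel V)
    (c : nat) (p : V -> V -> 'I_c -> 'I_c -> R) : Prop :=
  forall a b : V, legal_questions E a b -> win_probability p a b = 1.

Definition cexp (R : realType) (z : R[i]) : R[i] :=
  (expR (complex.Re z))%:C * (cos (complex.Im z) +i* sin (complex.Im z)).

(* States are column vectors; operators act on them by left multiplication. *)
Definition ket (R : realType) (N : nat) (i : 'I_N) : 'cV[R[i]]_N :=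
  delta_mx i 0.

(* [x *t y] has [1 * 1] columns; the ascription makes it a column vector. *)
Definition tens_state (R : realType) (M N : nat)
    (x : 'cV[R[i]]_M) (y : 'cV[R[i]]_N) : 'cV[R[i]]_(M * N) := x *t y.

(* Born rule: the squared modulus of <phi|psi>; [^t*] is the adjoint. *)
Definition born (R : realType) (n : nat) (phi psi : 'cV[R[i]]_n) : R :=
  ComplexField.Normc.normc ((phi ^t* *m psi) 0 0) ^+ 2.

Definition omega (R : realType) (N : nat) : R[i] :=
  cexp ((2 * pi / N%:R : R) *i).

Definition QFT (R : realType) (N : nat) : 'M[R[i]]_N :=
  \matrix_(j < N, i < N) (((Num.sqrt (N%:R : R))^-1)%:C * omega R N ^+ (i * j)).

Definition phase_shift (R : realType) (N : nat) (l : bits N) : 'M[R[i]]_N :=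
  diag_mx (\row_(i < N) (-1) ^+ l i).

Definition shared_state (R : realType) (N : nat) : 'cV[R[i]]_(N * N) :=
  ((Num.sqrt (N%:R : R))^-1)%:C *: \sum_(i < N) tens_state (ket R i) (ket R i).

(* QFT is invertible for N > 0, so [invmx] is its actual inverse. *)
Definition final_state (R : realType) (N : nat) (a b : bits N) :
    'cV[R[i]]_(N * N) :=
  (QFT R N *t invmx (QFT R N)) *m
    ((phase_shift R a *t phase_shift R b) *m shared_state R N).

Definition qft_protocol (R : realType) (N : nat) (a b : bits N)
    (jA jB : 'I_N) : R :=
  born (tens_state (ket R jA) (ket R jB)) (final_state R a b).

(* Main.v *)
(** Let [F] be the Fourier matrix.  As [F] is symmetric and unitary, the
    amplitudes of the final state form the matrix [C = N^{-1/2} F P_a P_b F^*],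
    a unitary matrix divided by [sqrt N]; hence the outcome probabilities
    [|C jA jB|^2] sum to [1], and it suffices that losing outcomes have amplitude
    [0].  If [a = b] then [P_a P_b = 1], so [C] is diagonal.  If [a] and [b]
    differ in [N / 2] places then every diagonal entry of [C] is proportional to
    [\sum_i (-1)^(a_i + b_i) = 0]. *)
Require Import Defs.
From mathcomp Require Import all_boot all_order all_algebra.
From mathcomp Require Import complex mxtens.
From mathcomp Require Import all_classical all_reals all_analysis.
From mathcomp Require Import zify ring lra.

Set Implicit Arguments.
Unset Strict Implicit.
Unset Printing Implicit Defensive.

Import Order.TTheory GRing.Theory Num.Theory.
Local Open Scope ring_scope.
Local Open Scope complex_scope.
Local Open Scope sesquilinear_scope.

(** Here [1 - cos x = 2 * sin (x / 2) ^+ 2], and [x / 2] lies strictly between [0] and [pi], where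
    the sine is positive. *)
Lemma cos_neq1 (R : realType) (x : R) : 0 < x < 2 * pi -> cos x != 1.
Proof.
move=> /andP[x0 x2pi].
have s0 : 0 < sin (x / 2) by apply: sin_gt0_pi; lra.
have -> : x = (x / 2) *+ 2 by rewrite mulr2n -splitr.
rewrite cos_mulr2n cos2sin2; apply/eqP.
have : 0 < sin (x / 2) ^+ 2 by exact: exprn_gt0.
lra.
Qed.

Lemma expr_cos_sin (R : realType) (x : R) n :
  (cos x +i* sin x) ^+ n = cos (x *+ n) +i* sin (x *+ n).
Proof.
elim: n => [|n IHn]; first by rewrite expr0 mulr0n cos0 sin0.
rewrite exprS IHn mulrS cosD sinD; simpc.
by congr (_ +i* _); ring.
Qed.

Lemma omegaE (R : realType) N :
  omega R N = cos (2 * pi / N%:R) +i* sin (2 * pi / N%:R).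
Proof. by rewrite /omega /cexp /= expR0 mul1r. Qed.

Lemma omega_prim_root (R : realType) N : (0 < N)%N ->
  N.-primitive_root (omega R N).
Proof.
move=> N0; have NR : 0 < N%:R :> R by rewrite ltr0n.
(* Primitivity unfolds to: for each [i < N], the power [i.+1] of [omega] is [1] exactly when
   [i.+1 = N]. *)
apply/andP; split=> //; apply/forallP => i; rewrite unity_rootE omegaE.
rewrite expr_cos_sin; apply/eqP.
have [->|iN] := eqVneq i.+1 N.
  rewrite -[_ *+ N]mulr_natr (divfK (lt0r_neq0 NR)).
  by rewrite mulr_natl cos2pi sin2pi; exact/eqP.
(* A smaller power has its angle strictly between [0] and [2 * pi], so its real part already differs
   from [1]. *)
apply/negbTE; rewrite eq_complex negb_and /= cos_neq1//.
have iN' : (i.+1 < N)%N by rewrite ltn_neqAle iN ltn_ord.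
rewrite -[_ *+ i.+1]mulr_natr -mulrA; apply/andP; split.
  by rewrite !mulr_gt0 ?pi_gt0 ?invr_gt0 ?ltr0n.
rewrite -[ltRHS]mulr1 ltr_pM2l ?mulr_gt0 ?pi_gt0//.
by rewrite mulrC ltr_pdivrMr// mul1r ltr_nat.
Qed.

Lemma omega_conj (R : realType) N :
  Num.conj (omega R N) = (omega R N)^-1.
Proof.
have ww : omega R N * Num.conj (omega R N) = 1.
  rewrite omegaE -normCK normc_def /= cos2Dsin2 sqrtr1.
  by rewrite expr1n.
by rewrite -[RHS]mulr1 -ww mulKf//; apply/eqP => w0; move: ww;
  rewrite w0 mul0r => /esym/eqP; rewrite oner_eq0.
Qed.

(** Multiplied by the nonzero factor [z ^+ m - 1], the geometric sum telescopes to
    [(z ^+ N) ^+ m - 1 = 0]. *)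
Lemma sum_prim_root_expr (K : fieldType) N (z : K) m :
  N.-primitive_root z -> ~~ (N %| m)%N -> \sum_(i < N) (z ^+ m) ^+ i = 0.
Proof.
move=> zN; rewrite (prim_order_dvd zN) => zm.
have : (z ^+ m - 1) * \sum_(i < N) (z ^+ m) ^+ i = 0.
  by rewrite -subrX1 -exprM mulnC exprM (prim_expr_order zN) expr1n subrr.
by move/eqP; rewrite mulf_eq0 subr_eq0 (negbTE zm) => /eqP.
Qed.

Lemma tens_ket_adjoint_mul (R : realType) N (i j : 'I_N)
    (v : 'cV[R[i]]_(N * N)) :
  ((tens_state (ket R i) (ket R j)) ^t* *m v) 0 0 = v (mxtens_index (i, j)) 0.
Proof.
rewrite !mxE (bigD1 (mxtens_index (i, j))) //= big1 ?addr0.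
  rewrite !mxE !mxtens_indexK/= !eqxx !ord1 /=.
  by rewrite mulr1 rmorph1 mul1r.
move=> k; case: (mxtens_indexP k) => i' j' ne.
rewrite !mxE !mxtens_indexK /= !ord1 !eqxx !andbT.
have [ei|_] := eqVneq i' i; last by rewrite mul0r rmorph0 mul0r.
have [ej|_] := eqVneq j' j; last by rewrite mulr0 rmorph0 mul0r.
by rewrite ei ej eqxx in ne.
Qed.

Lemma normc_sqr (R : realType) (x : R[i]) :
  (ComplexField.Normc.normc x ^+ 2)%:C = x * Num.conj x.
Proof. by rewrite -normCK rmorphXn. Qed.

Lemma phase_shift_unitary (R : realType) N (l : bits N) :
  phase_shift R l \is unitarymx.
Proof.
apply/unitarymxP; rewrite /phase_shift tr_diag_mx map_diag_mx mulmx_diag.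
rewrite -diag_const_mx; congr diag_mx; apply/rowP => i; rewrite !mxE.
by rewrite rmorphXn rmorphN1 -exprMn mulrNN mulr1 expr1n.
Qed.

(** Each summand is [1] minus twice the indicator of [a i != b i]. *)
Lemma sum_sign_hamming (R : comNzRingType) N (a b : bits N) :
  \sum_i (-1) ^+ a i * (-1) ^+ b i = N%:R - (hamming a b)%:R *+ 2 :> R.
Proof.
rewrite /hamming -sum1_card natr_sum (eq_bigl _ _ (fun=> finset.in_set _ _)).
rewrite [X in _ - X *+ 2]big_mkcond /=.
have -> : N%:R = \sum_(i < N) 1 :> R by rewrite sumr_const card_ord.
rewrite -sumrMnl -sumrB; apply: eq_bigr => i _.
by case: (a i); case: (b i); rewrite /= ?expr0 ?expr1; ring.
Qed.

Lemma sqrV_sqrtC (R : realType) N :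
  ((Num.sqrt (N%:R : R))^-1)%:C * ((Num.sqrt (N%:R : R))^-1)%:C
  = N%:R^-1 :> R[i].
Proof.
by rewrite -rmorphM -expr2 exprVn sqr_sqrtr ?ler0n// fmorphV rmorph_nat.
Qed.

Lemma QFT_unitary (R : realType) N : (0 < N)%N -> QFT R N \is unitarymx.
Proof.
move=> N0; apply/unitarymxP/matrixP => j k; rewrite !mxE.
set w := omega R N; set s := (Num.sqrt (N%:R : R))^-1.
have wN : N.-primitive_root w by exact: omega_prim_root.
have w0 : w != 0 by rewrite (prim_root_eq0 wN) -lt0n.
(* The exponent [j + (N - k)] represents [j - k] modulo [N] without leaving the naturals. *)
have term i : (s%:C * w ^+ (i * j)) * Num.conj (s%:C * w ^+ (i * k))
    = N%:R^-1 * (w ^+ (j + (N - k))) ^+ i.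
  rewrite rmorphM rmorphXn /= omega_conj.
  have -> : Num.conj (s%:C) = s%:C by exact: conjc_real.
  rewrite mulrACA sqrV_sqrtC exprD.
  have -> : w ^+ (N - k) = w^-1 ^+ k.
    apply: (@mulIf _ (w ^+ k)); first by rewrite expf_neq0.
    rewrite -exprD subnK ?(ltnW (ltn_ord k))// (prim_expr_order wN).
    by rewrite -exprMn mulVf// expr1n.
  by rewrite (mulnC i j) (mulnC i k) !exprM -exprMn.
under eq_bigr => i _ do rewrite !mxE term.
rewrite -mulr_sumr; have [<-|jk] := eqVneq j k.
  rewrite subnKC ?(ltnW (ltn_ord j))// (prim_expr_order wN).
  under eq_bigr do rewrite expr1n.
  by rewrite sumr_const card_ord mulVf// pnatr_eq0 -lt0n.
rewrite (sum_prim_root_expr wN) ?mulr0//.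
(* As [j, k < N], the exponent lies strictly between [0] and [2 * N]; the only multiple of [N] there
   is [N] itself, which forces [j = k]. *)
apply/negP => /dvdnP[q qE].
case/eqP: jk; apply: val_inj => /=.
have := ltn_ord j; have := ltn_ord k.
by case: q qE => [|[|q]] qE; nia.
Qed.

Lemma QFT_sym (R : realType) N : (QFT R N)^T = QFT R N.
Proof. by apply/matrixP => i j; rewrite !mxE mulnC. Qed.

(* Transposing an operator moves it from one half of the maximally entangled
   state to the other. *)
Lemma tens_shared_stateE (R : realType) N (A B : 'M[R[i]]_N) (i j : 'I_N) :
  ((A *t B) *m shared_state R N) (mxtens_index (i, j)) 0 =
  ((Num.sqrt (N%:R : R))^-1)%:C * (A *m B^T) i j.
Proof.
rewrite /shared_state -scalemxAr mxE mulmx_sumr summxE mxE; congr (_ * _).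
apply: eq_bigr => k _.
have -> : (A *t B) *m tens_state (ket R k) (ket R k)
    = tens_state (A *m ket R k) (B *m ket R k) by exact: (tensmx_mul A B (ket R k) (ket R k)).
have -> : 0 = mxtens_index (0 : 'I_1, 0 : 'I_1) :> 'I_1 by exact: val_inj.
by rewrite [LHS]tensmxE /ket -!colE !mxE.
Qed.

(** The matrix [C] of the overview, with rows for Alice's outcomes and columns for Bob's. Bob's
    inverse QFT, transposed onto Alice's side, becomes the right factor because the QFT is symmetric
    and unitary. *)
Definition amplitude (R : realType) N (a b : bits N) : 'M[R[i]]_N :=
  ((Num.sqrt (N%:R : R))^-1)%:C *:
    (QFT R N *m (phase_shift R a *m phase_shift R b) *m (QFT R N) ^t*).

Lemma qft_protocolE (R : realType) N (a b : bits N) (i j : 'I_N) : (0 < N)%N ->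
  (qft_protocol R a b i j)%:C =
  amplitude R a b i j * Num.conj (amplitude R a b i j).
Proof.
move=> N0; rewrite /qft_protocol /born normc_sqr tens_ket_adjoint_mul.
rewrite /final_state mulmxA tensmx_mul tens_shared_stateE.
rewrite (invmx_unitary (QFT_unitary R N0)) QFT_sym.
rewrite trmx_mul map_trmx QFT_sym /phase_shift tr_diag_mx.
by rewrite /amplitude QFT_sym [in RHS]mxE /phase_shift !mulmxA.
Qed.

(** The sum of the squared moduli of the entries of [C] is the trace of [C] times its adjoint, that
    is, of the identity divided by [N]. *)
Lemma sum_qft_protocol (R : realType) N (a b : bits N) : (0 < N)%N ->
  \sum_i \sum_j qft_protocol R a b i j = 1.
Proof.
move=> N0.
have U : QFT R N *m (phase_shift R a *m phase_shift R b) *m (QFT R N) ^t*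
    \is unitarymx.
  by rewrite !mul_unitarymx ?trmxC_unitary ?phase_shift_unitary ?QFT_unitary.
apply: (@complexI R); rewrite rmorph1 rmorph_sum /=.
have -> : \sum_i (\sum_j qft_protocol R a b i j)%:C
    = \tr (amplitude R a b *m (amplitude R a b) ^t*).
  apply: eq_bigr => i _; rewrite rmorph_sum mxE; apply: eq_bigr => j _ /=.
  by rewrite qft_protocolE// !mxE.
rewrite /amplitude linearZ /= map_mxZ -scalemxAl -scalemxAr.
rewrite (unitarymxP U) !mxtraceZ mxtrace1.
rewrite /=; have -> (s : R) : Num.conj (s%:C) = s%:C by exact: conjc_real.
by rewrite mulrA sqrV_sqrtC mulVf ?pnatr_eq0 -?lt0n.
Qed.

Lemma mul_phase_shift (R : realType) N (a b : bits N) :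
  phase_shift R a *m phase_shift R b =
  diag_mx (\row_i ((-1) ^+ a i * (-1) ^+ b i)).
Proof. by rewrite mulmx_diag; congr diag_mx; apply/rowP => i; rewrite !mxE. Qed.

Lemma mul_phase_shift_id (R : realType) N (a : bits N) :
  phase_shift R a *m phase_shift R a = 1%:M.
Proof.
rewrite mul_phase_shift -diag_const_mx; congr diag_mx; apply/rowP => i.
by rewrite !mxE -exprMn mulrNN mulr1 expr1n.
Qed.

Lemma QFT_normC (R : realType) N (j i : 'I_N) :
  QFT R N j i * Num.conj (QFT R N j i) = N%:R^-1.
Proof.
have N0 : (0 < N)%N by case: N j {i} => // -[].
have w0 : omega R N != 0.
  by rewrite (prim_root_eq0 (omega_prim_root R N0)) -lt0n.
rewrite mxE rmorphM rmorphXn /= omega_conj.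
have -> (s : R) : Num.conj (s%:C) = s%:C by exact: conjc_real.
by rewrite mulrACA sqrV_sqrtC -exprMn divff// expr1n mulr1.
Qed.

(** All entries of the Fourier matrix have squared modulus [1 / N], so conjugating a diagonal matrix
    by it puts the mean of the diagonal in every diagonal position. *)
Lemma amplitude_diag (R : realType) N (a b : bits N) (j : 'I_N) :
  amplitude R a b j j = ((Num.sqrt (N%:R : R))^-1)%:C *
    (N%:R^-1 * (N%:R - (hamming a b)%:R *+ 2)).
Proof.
rewrite -sum_sign_hamming mulr_sumr /amplitude mul_phase_shift mxE.
rewrite mxE; congr (_ * _); apply: eq_bigr => i _.
have -> : (QFT R N ^t*) i j = Num.conj (QFT R N j i) by rewrite !mxE.
by rewrite mul_mx_diag mxE mulrAC QFT_normC mxE.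
Qed.

Theorem theorem3p1 (R : realType) (k : nat) (hk : (0 < k)%N) :
  wins_with_probability_one (@hadamard_edge (4 * k)) (@qft_protocol R (4 * k)).
Proof.
have N0 : (0 < 4 * k)%N by rewrite muln_gt0.
move=> a b ab.
(* Replacing [1] by the total probability allows a termwise comparison, in which only losing
   outcomes remain to be shown null. *)
rewrite -(sum_qft_protocol R a b N0); apply: eq_bigr => jA _.
rewrite big_mkcond; apply: eq_bigr => jB _; case: ifPn => // lost.
apply/esym/(@complexI R); rewrite qft_protocolE// rmorph0.
suff -> : amplitude R a b jA jB = 0 by rewrite mul0r.
have [eab|nab] := eqVneq a b.
  move: lost; rewrite /winning eab eqxx /= => /negbTE nj.
  rewrite /amplitude mul_phase_shift_id mulmx1.
  by rewrite (unitarymxP (QFT_unitary R N0)) !mxE nj mulr0.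
move: ab; rewrite /legal_questions (negbTE nab) => /eqP hab.
move: lost; rewrite /winning (negbTE nab) /= orbF negbK => /eqP <-.
rewrite amplitude_diag hab -mulrnA.
(* The halving is exact because [4 * k] is even, so the signs cancel completely. *)
have -> : (4 * k %/ 2 * 2 = 4 * k)%N by lia.
by rewrite subrr !mulr0.
Qed.
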